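(* Let $\mathcal C$ be a fractionally $\mathsf{tree}\text{-}\alpha$-fragile graph class with fragility function $f$. Then, for every integer $r\ge 2$ and every $n$-vertex graph $G\in\mathcal C$, there exists a balanced separator $S$ of $G$ such that $$\alpha(G[S])\le \frac{n}{r}+f(r).$$
   Context: All graphs are finite, simple and (unless stated otherwise) nonempty; $\mathbb N$ is the set of positive integers; $\alpha$ denotes independence number. A balanced separator of $G$ is a set $S\subseteq V(G)$ such that every connected component of $G-S$ has at most $2|V(G)|/3$ vertices. The tree-independence number $\mathsf{tree}\text{-}\alpha(G)$ is the minimum over all tree decompositions of $G$ of the maximum of $\alpha(G[X])$ over all bags $X$. For $0\le\beta\le 1$, a $\beta$-general cover of $G$ is a nonempty finite multiset $\mathcal A$ of subsets of $V(G)$ such that each vertex belongs to at least $\beta|\mathcal A|$ elements of $\mathcal A$ (counted with multiplicity); its $\mathsf{tree}\text{-}\alpha$-width is $\max_{A\in\mathcal A}\mathsf{tree}\text{-}\alpha(G[A])$ (the empty graph contributes value $0$). A graph class $\mathcal C$ is fractionally $\mathsf{tree}\text{-}\alpha$-fragile with fragility function $f\colon\mathbb N\to\mathbb N$ if, for every $r\in\mathbb N$, every $G\in\mathcal C$ has a $(1-1/r)$-general cover with $\mathsf{tree}\text{-}\alpha$-width at most $f(r)$. *)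

(* Defs.v *)
From mathcomp Require Import all_boot all_order all_algebra.
From mathcomp Require Import boolp.
Set Implicit Arguments.
Unset Strict Implicit.
Unset Printing Implicit Defensive.
Import Order.TTheory GRing.Theory Num.Theory.

(* Finite simple graphs. The vertex type may be empty: empty graphs arise as
   induced subgraphs. *)
Record sgraph := SGraph {
  vertex :> finType;
  adj : rel vertex;
  adj_sym : symmetric adj;
  adj_irrefl : irreflexive adj }.

Section Graph.
Variable G : sgraph.
Implicit Types (A S : {set G}).

Definition induced_rel A : rel {x : G | x \in A} :=
  fun x y => adj (val x) (val y).

Lemma induced_sym A : symmetric (@induced_rel A).
Proof. by move=> x y; apply: adj_sym. Qed.

Lemma induced_irrefl A : irreflexive (@induced_rel A).
Proof. by move=> x; apply: adj_irrefl. Qed.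

Definition induced A : sgraph := SGraph (@induced_sym A) (@induced_irrefl A).

Definition independent S : bool :=
  [forall x in S, forall y in S, ~~ adj x y].

Definition alpha : nat := \max_(S : {set G} | independent S) #|S|.

Definition components : {set {set G}} :=
  equivalence_partition (connect (@adj G)) [set: G].

Definition connected_graph : Prop :=
  0 < #|G| /\ forall x y : G, connect (@adj G) x y.

Definition acyclic : Prop :=
  forall p : seq G, 2 < size p -> ~ ucycle (@adj G) p.

Definition is_tree : Prop := connected_graph /\ acyclic.

End Graph.

Definition balanced_separator (G : sgraph) (S : {set G}) : Prop :=
  forall K, K \in components (induced (~: S)) -> 3 * #|K| <= 2 * #|G|.

Record tree_decomposition (G : sgraph) := TreeDecomposition {
  td_tree : sgraph;
  td_bag : td_tree -> {set G};
  td_is_tree : is_tree td_tree;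
  td_vertex : forall v : G, exists t, v \in td_bag t;
  td_edge : forall u v : G, adj u v ->
    exists t, (u \in td_bag t) && (v \in td_bag t);
  td_subtree : forall v : G,
    connected_graph (induced [set t | v \in td_bag t]) }.

Definition td_alpha (G : sgraph) (D : tree_decomposition G) : nat :=
  \max_(t : td_tree D) alpha (induced (td_bag t)).

Section TrivialDecomposition.
Variable G : sgraph.

Definition point_graph : sgraph :=
  @SGraph unit (fun _ _ => false) (fun _ _ => erefl) (fun _ => erefl).

Lemma point_is_tree : is_tree point_graph.
Proof.
split; first by split; [rewrite card_unit | case; case; apply: connect0].
by case=> [|[] [|[] p]] //= _ /andP[].
Qed.

Lemma trivial_td_subtree (v : G) :
  connected_graph (induced [set t : point_graph | v \in [set: G]]).
Proof.
have tP : tt \in [set t : point_graph | v \in [set: G]] by rewrite !inE.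
split; first by apply/card_gt0P; exists (Sub tt tP).
move=> x y; have -> : x = y; last exact: connect0.
by apply: val_inj; case: (val x); case: (val y).
Qed.

Definition trivial_td : tree_decomposition G :=
  @TreeDecomposition G point_graph (fun _ => [set: G]) point_is_tree
    (fun v => ex_intro _ tt (in_setT v))
    (fun u v _ => ex_intro _ tt (introT andP (conj (in_setT u) (in_setT v))))
    trivial_td_subtree.

Lemma td_alpha_exists :
  exists k, `[< exists D : tree_decomposition G, td_alpha D = k >].
Proof. by exists (td_alpha trivial_td); apply/asboolP; exists trivial_td. Qed.

Definition tree_alpha : nat := ex_minn td_alpha_exists.

End TrivialDecomposition.

Section Cover.
Local Open Scope ring_scope.

(* Finite multisets of vertex sets are represented by lists. *)
Definition general_cover (R : realFieldType) (beta : R) (G : sgraph)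
    (A : seq {set G}) : Prop :=
  [/\ 0 <= beta <= 1, A != [::] &
      forall v : G,
        beta * (size A)%:R <= (count (fun X : {set G} => v \in X) A)%:R].

Definition tree_alpha_width (G : sgraph) (A : seq {set G}) : nat :=
  \max_(X <- A) tree_alpha (induced X).

(* [f] is a function on positive integers: its value at 0 is irrelevant. *)
Definition tree_alpha_fragile (C : sgraph -> Prop) (f : nat -> nat) : Prop :=
  forall r : nat, (0 < r)%N ->
    (0 < f r)%N /\
    forall G : sgraph, C G ->
      exists2 A : seq {set G},
        general_cover (1 - r%:R^-1 : rat) A & (tree_alpha_width A <= f r)%N.

End Cover.

(* Main.v *)
Require Import Defs.
From mathcomp Require Import all_boot all_order all_algebra.
From mathcomp Require Import boolp.
From mathcomp Require Import lra.
Set Implicit Arguments.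
Unset Strict Implicit.
Unset Printing Implicit Defensive.
Import Order.TTheory GRing.Theory Num.Theory.

(** Averaging over the cover yields a member [A] containing at least [(1 -
    1/r) n] vertices ([general_cover_large_member]), and [G[A]] has a tree
    decomposition all of whose bags have independence number at most [f r].
    The classical centroid argument for tree decompositions ([balanced_bag])
    gives a bag [B] such that every component of [G[A] - B] has at most [|A| /
    2] vertices. Take [S] to be [B] together with all the vertices outside
    [A]. Then [G - S] and [G[A] - B] are the same graph, so [S] is a balanced
    separator, and an independent subset of [S] has at most [n / r] vertices
    outside [A] and at most [f r] in [B] ([alpha_lift_separator]).

    For the centroid argument, suppose that every node [t] of the tree leaves
    a component [K_t] with more than half of the vertices. The nodes whose
    bags meet [K_t] avoid [t] and lie on the far side of a single neighbour
    [next t] of [t] ([neighbor_towards], [region_nodes_connected]). A self-map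
    of a finite set has a periodic point; as the tree has no cycle and [next
    t] is a neighbour of [t], the period is two, that is, there is a tree edge
    [st] with [next s = t] and [next t = s]. But [K_s] and [K_t] share a
    vertex, so some node [u] is joined to [s] off [t] and to [t] off [s]: the
    edge [st] would lie on a cycle ([acyclic_edge_separates]). *)

(** * Walks avoiding a set of vertices *)

Section Avoiding.
Variable G : sgraph.
Implicit Types (B : {set G}) (x y : G).

(** Deleting [B] is encoded on the vertex type of [G] itself, so that
    reachability off different sets can be compared without changing types. *)
Definition avoiding B : rel G :=
  [rel x y | [&& adj x y, x \notin B & y \notin B]].

Definition region B x : {set G} := [set y | connect (avoiding B) x y].

Lemma avoiding_connect_sym B : connect_sym (avoiding B).
Proof.
apply: sym_connect_sym => x y; rewrite /avoiding /= adj_sym.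
by case: (x \in B); case: (y \in B).
Qed.

End Avoiding.

Lemma connect_homo (T U : finType) (e : rel T) (e' : rel U) (h : T -> U) :
  (forall x y, e x y -> connect e' (h x) (h y)) ->
  forall x y, connect e x y -> connect e' (h x) (h y).
Proof.
move=> eh x y /connectP[p]; elim: p x => [|z p IHp] x /=.
  by move=> _ ->; apply: connect0.
by case/andP=> /eh xz pz yE; apply: connect_trans xz (IHp z pz yE).
Qed.

(** * Centroid bags of tree decompositions *)

Section Trees.
Variable T : sgraph.
Implicit Types s t u : T.

(** A shortest walk from [t] to [u] leaves [t] at its first step and never
    comes back, so that its second node is on the side of [u]. *)
Lemma neighbor_towards t u : connect (@adj T) t u -> u != t ->
  exists2 s, adj t s & connect (avoiding [set t]) s u.
Proof.
case/connectP=> p0 p0P ->; case/shortenP: p0P => [[|s p]] /=.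
  by rewrite eqxx.
case/andP=> ts sp; rewrite inE negb_or => /and3P[/andP[ts' tp] _ _] _ _.
exists s => //; apply/connectP; exists p => //.
elim: p s sp tp ts' {ts} => [|z p IHp] s //=.
case/andP=> sz zp; rewrite inE negb_or => /andP[tz tp] ts.
by rewrite /avoiding /= !inE sz !(eq_sym _ t) ts tz IHp.
Qed.

(** A walk from [s] to [t] that misses the edge [st] closes up with this edge
    to a cycle. *)
Lemma acyclic_edge_separates s t u : acyclic T -> adj s t ->
  connect (avoiding [set t]) s u -> connect (avoiding [set s]) t u -> False.
Proof.
move=> acT st su tu.
pose e : rel T := [rel x y | [&& adj x y, (x, y) != (s, t) & (x, y) != (t, s)]].
have sub w : (w \in [set s; t]) ->
    subrel (avoiding [set w]) e.
  move=> wst x y /and3P[xy]; rewrite !inE => xw yw; rewrite /e /= xy !xpair_eqE /=.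
  by move: wst xw yw; rewrite !inE => /orP[] /eqP-> /negPf-> /negPf->;
     rewrite !andbF.
have {}su : connect e s u.
  by apply: connect_sub su => x y xy; apply/connect1/(sub t); rewrite ?set22.
have {}tu : connect e u t.
  move: tu; rewrite avoiding_connect_sym; apply: connect_sub => x y xy.
  by apply/connect1/(sub s); rewrite ?set21.
case/connectP: (connect_trans su tu) => p0 p0P tE.
case/shortenP: p0P tE => p ep up _ tE.
have szp : 1 < size p.
  case: p ep up tE => [|z [|z' p]] //= => [_ _ tE|].
    by move: st; rewrite tE adj_irrefl.
  by rewrite andbT => /and3P[_ + _] _ tE; rewrite tE eqxx.
apply: (acT (s :: p)) => //; apply/andP; split=> //=.
rewrite rcons_path -tE (adj_sym t) st andbT.
by apply: sub_path ep => x y /and3P[].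
Qed.

(** Some orbit of [next] is a cycle of the graph, and only its length can keep
    it from contradicting acyclicity. *)
Lemma acyclic_next_involutive_at (next : T -> T) t0 : acyclic T ->
  (forall t, adj t (next t)) -> exists t, next (next t) = t.
Proof.
move=> acT adjN.
have /trajectP[m mlt itE] := looping_order next t0.
pose t := iter m next t0; exists t.
have per : exists k, iter k.+1 next t = t.
  exists (order next t0 - m).-1.
  by rewrite prednK ?subn_gt0 // -iterD subnK // ltnW.
have cyc : fcycle next (orbit next t) by apply/(orbitPcycle 3 0).
have itt : iter (order next t) next t = t by apply/(orbitPcycle 3 4).
have : size (orbit next t) <= 2.
  rewrite leqNgt; apply/negP=> /acT; apply; rewrite /ucycle orbit_uniq andbT.
  by apply: sub_cycle cyc => x y /eqP<-.
rewrite size_orbit; move: itt (order_gt0 next t).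
case: (order next t) => [|[|[|k]]] //= tE _ _.
by have := adjN t; rewrite tE adj_irrefl.
Qed.

End Trees.

Section CentroidBag.
Variables (G : sgraph) (D : tree_decomposition G).
Local Notation T := (td_tree D).
Local Notation bag := (@td_bag G D).

(** The nodes whose bags contain [v] form a subtree, which misses [t]. *)
Lemma vertex_nodes_connected t u u' (v : G) : v \notin bag t ->
  v \in bag u -> v \in bag u' -> connect (avoiding [set t]) u u'.
Proof.
move=> vt vu vu'; have [_ cv] := td_subtree D v.
have uP : u \in [set w | v \in bag w] by rewrite inE.
have u'P : u' \in [set w | v \in bag w] by rewrite inE.
apply: (connect_homo (h := val) _ (cv (Sub u uP) (Sub u' u'P))) => x y xy.
apply: connect1; rewrite /avoiding /= !inE.
apply/and3P; split; first exact: xy.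
- by apply: contraNneq vt => <-; have := valP x; rewrite inE.
- by apply: contraNneq vt => <-; have := valP y; rewrite inE.
Qed.

(** Adjacent vertices share a bag, so the subtrees of the vertices met along a
    walk off the bag of [t] overlap successively. *)
Lemma region_nodes_connected t u u' (v w : G) : v \notin bag t ->
  connect (avoiding (bag t)) v w -> v \in bag u -> w \in bag u' ->
  connect (avoiding [set t]) u u'.
Proof.
move=> vt /connectP[p]; elim: p v u vt => [|z p IHp] v u vt /=.
  by move=> _ -> vu vu'; apply: vertex_nodes_connected vu vu'.
case/andP=> /and3P[vz _ zt] zp wE vu wu'.
have [x /andP[vx zx]] := td_edge D vz.
exact: connect_trans (vertex_nodes_connected vt vu vx) (IHp z x zt zp wE zx wu').
Qed.

Lemma balanced_bag : exists t, forall x, x \notin bag t ->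
  2 * #|region (bag t) x| <= #|G|.
Proof.
have [[/card_gt0P[t0 _] connT] acT] := td_is_tree D.
pose good t := [forall x, (x \notin bag t) ==> (2 * #|region (bag t) x| <= #|G|)].
have [/existsP[t /forallP tP]|] := boolP [exists t, good t].
  by exists t => x; apply/implyP.
rewrite negb_exists => /forallP bad.
have bigP t : exists x, (x \notin bag t) && (#|G| < 2 * #|region (bag t) x|).
  have := bad t; rewrite negb_forall => /existsP[x].
  by rewrite negb_imply -ltnNge => xP; exists x.
have {bigP} [c cP] := choice bigP.
have nextP t : exists s, adj t s /\ forall v u, v \in region (bag t) (c t) ->
    v \in bag u -> connect (avoiding [set t]) s u.
  have /andP[ct _] := cP t; have [u0 cu0] := td_vertex D (c t).
  have [|s ts su0] := neighbor_towards (connT t u0).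
    by apply: contraNneq ct => u0t; rewrite u0t in cu0.
  exists s; split=> // v u; rewrite inE => cv vu.
  exact: connect_trans su0 (region_nodes_connected ct cv cu0 vu).
have {nextP} [next nextP] := choice nextP.
have [t nnt] := acyclic_next_involutive_at t0 acT (fun t => (nextP t).1).
set s := next t in nnt.
(* Two sets with more than half of the vertices each must meet. *)
have [v /andP[vt vs]] : exists v,
    (v \in region (bag t) (c t)) && (v \in region (bag s) (c s)).
  have /andP[_ bt] := cP t; have /andP[_ bs] := cP s.
  set Kt := region _ _ in bt *; set Ks := region _ _ in bs *.
  have : 0 < #|Kt :&: Ks|.
    rewrite lt0n; apply/negP=> /eqP I0.
    have := max_card (mem (Kt :|: Ks)); rewrite cardsU I0 subn0 leqNgt.
    move/negP; apply; rewrite -(ltn_pmul2l (isT : 0 < 2)) mulnDr.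
    by rewrite mul2n -addnn -addSn leq_add // ltnW.
  by case/card_gt0P=> v; rewrite inE => vP; exists v.
have [u vu] := td_vertex D v.
have su := (nextP t).2 v u vt vu; have tu := (nextP s).2 v u vs vu.
rewrite nnt in tu.
have st : adj s t by rewrite adj_sym; have [] := nextP t.
by case: (acyclic_edge_separates acT st su tu).
Qed.

End CentroidBag.

(** * Independent sets of induced subgraphs *)

Section InducedAlpha.
Variable G : sgraph.
Implicit Types (A B I S : {set G}).

Lemma card_preim_val A I : I \subset A ->
  #|[set x : induced A | val x \in I]| = #|I|.
Proof.
move=> /subsetP IA; rewrite -(card_imset _ val_inj); apply: eq_card => x.
apply/imsetP/idP=> [[y + ->]|xI]; first by rewrite inE.
by exists (Sub x (IA x xI)); rewrite ?inE SubK.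
Qed.

Lemma independent_preim_val A I : independent I ->
  independent [set x : induced A | val x \in I].
Proof.
move=> /forall_inP indI; apply/forall_inP=> x; rewrite inE => xI.
apply/forall_inP=> y; rewrite inE => yI.
exact: (forall_inP (indI _ xI)).
Qed.

Lemma card_independent_le_alpha A I : independent I -> I \subset A ->
  #|I| <= alpha (induced A).
Proof.
move=> indI /card_preim_val<-.
by have := independent_preim_val A indI; apply: leq_bigmax_cond.
Qed.

Lemma alpha_induced_le A m :
  (forall I, independent I -> I \subset A -> #|I| <= m) ->
  alpha (induced A) <= m.
Proof.
move=> Im; apply/bigmax_leqP=> J /forall_inP indJ.
rewrite -(card_imset _ val_inj); apply: Im.
  apply/forall_inP=> _ /imsetP[x xJ ->]; apply/forall_inP=> _ /imsetP[y yJ ->].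
  exact: (forall_inP (indJ _ xJ)).
by apply/subsetP=> _ /imsetP[x _ ->]; apply: valP.
Qed.

End InducedAlpha.

(** * Separators from large induced subgraphs *)

Section Lift.
Variables (G : sgraph) (A : {set G}) (B : {set induced A}).

(** The lift of a separator [B] of [G[A]]: deleting it from [G] leaves the same
    graph as deleting [B] from [G[A]]. *)
Definition lift_separator : {set G} := ~: A :|: [set val x | x in B].

Lemma alpha_lift_separator :
  alpha (induced lift_separator) <= #|~: A| + alpha (induced B).
Proof.
apply: alpha_induced_le => I indI /subsetP IS.
rewrite -(cardsID A I) addnC leq_add //.
  by rewrite subset_leq_card // setDE subsetIr.
have IA : I :&: A \subset A by apply: subsetIr.
rewrite -(card_preim_val IA); apply: card_independent_le_alpha.
  apply: independent_preim_val; move/forall_inP: indI => indI.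
  apply/forall_inP=> x /setIP[xI _]; apply/forall_inP=> y /setIP[yI _].
  exact: (forall_inP (indI _ xI)).
apply/subsetP=> x; rewrite !inE => /andP[/IS + xA].
by rewrite !inE xA /= mem_imset //; apply: val_inj.
Qed.

Lemma component_lift_separator K :
  K \in components (induced (~: lift_separator)) ->
  exists2 x, x \notin B & #|K| <= #|region B x|.
Proof.
have inA (x : induced (~: lift_separator)) : val x \in A.
  by have := valP x; rewrite !inE negb_or negbK => /andP[].
pose h x : induced A := Sub (val x) (inA x).
have hB x : h x \notin B.
  apply/negP=> xB; have := valP x; rewrite !inE negb_or => /andP[_ /negP].
  by apply; apply/imsetP; exists (h x); rewrite ?SubK.
have hinj : injective h.
  by move=> x y /(congr1 val); rewrite !SubK => /val_inj.
case/imsetP=> x _ ->; exists (h x) => //.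
rewrite -(card_imset _ hinj); apply/subset_leq_card/subsetP=> _ /imsetP[y + ->].
rewrite !inE /= => xy; apply: (connect_homo _ xy) => a b ab.
by apply: connect1; rewrite /avoiding /= !hB !andbT.
Qed.

Lemma balanced_lift_separator :
  (forall x, x \notin B -> 2 * #|region B x| <= #|A|) ->
  balanced_separator lift_separator.
Proof.
move=> regB K /component_lift_separator[x /regB Kle Kx].
have AG : #|A| <= #|G| by apply: max_card.
have : 2 * #|K| <= #|G|.
  by apply: leq_trans (leq_trans Kle AG); rewrite leq_mul2l.
move=> h; apply: (@leq_trans (2 * (2 * #|K|))).
  by rewrite mulnA leq_mul2r orbT.
by rewrite leq_mul2l.
Qed.

End Lift.

(** * Large members of general covers *)

Local Open Scope ring_scope.

(** Double counting: the sizes of the members add up to the number of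
    incidences, which is at least [beta * size A] for each vertex. *)
Lemma general_cover_large_member (R : realFieldType) (beta : R) (G : sgraph)
    (A : seq {set G}) : general_cover beta A ->
  exists2 X, X \in A & beta * #|G|%:R <= #|X|%:R.
Proof.
case=> _ A0 covA.
have [/hasP[X XA le]|/hasPn small] :=
    boolP (has (fun X : {set G} => beta * #|G|%:R <= #|X|%:R) A).
  by exists X.
have dbl : (\sum_(X <- A) #|X| = \sum_(v : G) count (fun X : {set G} => v \in X) A)%N.
  rewrite (eq_bigr (fun X : {set G} => \sum_(v : G) (v \in X : nat))%N); last first.
    by move=> X _; rewrite -sum1_card big_mkcond.
  rewrite exchange_big; apply: eq_bigr => v _.
  by rewrite -sum1_count [RHS]big_mkcond.
have lo : (beta * #|G|%:R) * (size A)%:R <= \sum_(X <- A) #|X|%:R.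
  rewrite -natr_sum dbl natr_sum -mulrA [X in beta * X]mulrC mulrA mulr_natr.
  by rewrite -sumr_const; apply: ler_sum.
have hi : \sum_(X <- A) #|X|%:R < (beta * #|G|%:R) * (size A)%:R.
  have -> : (beta * #|G|%:R) * (size A)%:R = \sum_(X <- A) beta * #|G|%:R.
    by rewrite big_const_seq count_predT iter_addr_0 mulr_natr.
  rewrite !big_seq; apply: ltr_sum.
    by case: A A0 {covA small dbl lo} => // X A _ /=; rewrite mem_head.
  by move=> X /small; rewrite -ltNge.
by have := le_lt_trans lo hi; rewrite ltxx.
Qed.

Lemma tree_alphaP (G : sgraph) :
  exists D : tree_decomposition G, td_alpha D = tree_alpha G.
Proof. by rewrite /tree_alpha; case: ex_minnP => k /asboolP. Qed.

Theorem theorem6p1 (C : sgraph -> Prop) (f : nat -> nat)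
    (C_nonempty : forall G : sgraph, C G -> (0 < #|G|)%N)
    (C_fragile : tree_alpha_fragile C f)
    (r : nat) (r_ge2 : (2 <= r)%N) (G : sgraph) (CG : C G) :
  exists S : {set G},
    balanced_separator S /\
    (alpha (induced S))%:R <= #|G|%:R / r%:R + (f r)%:R :> rat.
Proof.
have [_ /(_ G CG) [cov covP width]] := C_fragile r (ltnW r_ge2).
have [A Acov Alarge] := general_cover_large_member covP.
have [D DE] := tree_alphaP (induced A).
have Df : (td_alpha D <= f r)%N.
  by rewrite DE; apply: leq_trans width; apply: leq_bigmax_seq.
have [t tP] := balanced_bag D.
exists (lift_separator (td_bag t)); split.
  by apply: balanced_lift_separator => x /tP; rewrite card_sig.
have compl : #|~: A|%:R <= #|G|%:R / r%:R :> rat.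
  have : #|A|%:R + #|~: A|%:R = #|G|%:R :> rat by rewrite -natrD cardsC.
  by lra.
have bagf : (alpha (induced (td_bag t)))%:R <= (f r)%:R :> rat.
  by rewrite ler_nat; apply: leq_trans Df; rewrite /td_alpha; apply: leq_bigmax.
apply: le_trans (lerD compl bagf).
by rewrite -natrD ler_nat alpha_lift_separator.
Qed.
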